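(* Let $\omega\in\mathbb{R}^{\mathbb{N}}$ and let $(\mathbb{T}^{\mathbb{N}},\Phi_\omega)$ be the corresponding Kronecker flow. Then the frequency module $\mathscr{M}_\omega$ is a free abelian group if and only if $(\mathbb{T}^{\mathbb{N}},\Phi_\omega)$ is topologically conjugate to another Kronecker flow $(\mathbb{T}^{\mathbb{N}},\Phi_{\tilde\omega})$, $\tilde\omega\in\mathbb{R}^{\mathbb{N}}$, whose non-vanishing frequencies are rationally independent. If this is the case, $\mathscr{M}_\omega$ is isomorphic to $\mathbb{Z}^{(\mathrm{supp}(\tilde\omega))}$.
   Context: $\mathbb{N}=\{1,2,\dots\}$, $\mathbb{T}=\mathbb{R}/2\pi\mathbb{Z}$, and $\mathbb{T}^{\mathbb{N}}$ carries the product topology. For $\omega=(\omega_j)_{j\in\mathbb{N}}\in\mathbb{R}^{\mathbb{N}}$ the Kronecker flow is $\Phi_\omega^t(\theta)=(\Theta_j+\omega_jt+2\pi\mathbb{Z})_{j\in\mathbb{N}}$, where $\theta_j=\Theta_j+2\pi\mathbb{Z}$; the $\omega_j$ are called frequencies. For an index set $J$, $\mathbb{Z}^{(J)}$ is the group of finitely supported functions $J\to\mathbb{Z}$. The frequency module is the additive subgroup $\mathscr{M}_\omega=\{\sum_j\omega_j\nu_j:\nu\in\mathbb{Z}^{(\mathbb{N})}\}$ of $\mathbb{R}$. Real numbers $(\omega_j)_{j\in J}$ are rationally independent if $\sum_{j\in J}\omega_j\nu_j=0$ with $\nu\in\mathbb{Z}^{(J)}$ implies $\nu=0$. $\mathrm{supp}(\tilde\omega)=\{j:\tilde\omega_j\ne0\}$.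 Two flows $\Phi,\Psi$ on spaces $X,Y$ are topologically conjugate if there is a homeomorphism $h:X\to Y$ with $h\circ\Phi^t=\Psi^t\circ h$ for all $t\in\mathbb{R}$. An abelian group is free if it is isomorphic to $\mathbb{Z}^{(J)}$ for some index set $J$ (possibly empty). *)

(* Defs.v *)
From HB Require Import structures.
From mathcomp Require Import all_boot all_order all_algebra finmap.
From mathcomp Require Import generic_quotient ring_quotient.
From mathcomp Require Import all_classical all_reals all_analysis.
(* The notations of monalg are incompatible with those of all_analysis. *)
From mathcomp.multinomials Require Import -(notations) monalg.

Set Implicit Arguments.
Unset Strict Implicit.
Unset Printing Implicit Defensive.

Import Order.TTheory GRing.Theory Num.Theory.
Import numFieldTopology.Exports.

Local Open Scope classical_set_scope.
Local Open Scope ring_scope.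
Local Open Scope quotient_scope.

(* Z^(J): the library type of finitely supported functions J -> int, with its
   pointwise group structure.  An index type is a choiceType, which classically
   is no restriction. *)
Definition Zfs (J : choiceType) : zmodType := malg J int.

Definition int_comb (R : realType) (J : choiceType) (w : J -> R)
    (nu : Zfs J) : R :=
  \sum_(j <- msupp nu) w j * (mcoeff j nu)%:~R.

Definition rationally_independent (R : realType) (J : choiceType)
    (w : J -> R) : Prop :=
  forall nu : Zfs J, int_comb w nu = 0 -> nu = 0.

Definition zmod_isomorphic (G H : zmodType) : Prop :=
  exists f : {additive G -> H}, bijective f.

Definition free_abelian (G : zmodType) : Prop :=
  exists J : choiceType, zmod_isomorphic G (Zfs J).

Lemma int_comb_dom (R : realType) (J : choiceType) (w : J -> R)
    (nu : Zfs J) (A : {fset J}) :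
  (msupp nu `<=` A)%fset ->
  int_comb w nu = \sum_(j <- A) w j * (mcoeff j nu)%:~R.
Proof.
move=> sA; rewrite /int_comb; apply: big_fset_incl => // j _.
by rewrite -mcoeff_eq0 => /eqP ->; rewrite mulr0.
Qed.

Lemma int_combB (R : realType) (J : choiceType) (w : J -> R) (nu mu : Zfs J) :
  int_comb w (nu - mu) = int_comb w nu - int_comb w mu.
Proof.
pose A := (msupp nu `|` msupp mu `|` msupp (nu - mu))%fset.
have sA1 : (msupp nu `<=` A)%fset.
  by apply/fsubsetP => j jn; rewrite !inE jn.
have sA2 : (msupp mu `<=` A)%fset.
  by apply/fsubsetP => j jn; rewrite !inE jn orbT.
have sA3 : (msupp (nu - mu) `<=` A)%fset by apply: fsubsetUr.
rewrite (int_comb_dom w sA1) (int_comb_dom w sA2) (int_comb_dom w sA3).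
rewrite -sumrB; apply: eq_bigr => j _.
by rewrite mcoeffB rmorphB mulrBr.
Qed.

(* Sequences indexed by {1, 2, ...} are indexed here by nat, shifted by one. *)
Definition in_frequency_module (R : realType) (w : nat -> R) : {pred R} :=
  fun x => `[< exists nu : Zfs nat, x = int_comb w nu >].

Lemma in_frequency_module_zmod_closed (R : realType) (w : nat -> R) :
  zmod_closed (in_frequency_module w).
Proof.
split=> [|x y].
  by apply/asboolP; exists 0; rewrite -[0 in RHS](subrr 0) int_combB subrr.
move=> /asboolP[nu ->] /asboolP[mu ->].
by apply/asboolP; exists (nu - mu); rewrite int_combB.
Qed.

HB.instance Definition _ (R : realType) (w : nat -> R) :=
  GRing.isZmodClosed.Build R (in_frequency_module w)
    (in_frequency_module_zmod_closed w).

Record frequency_module (R : realType) (w : nat -> R) := FrequencyModule {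
  frequency_module_val :> R;
  _ : frequency_module_val \in in_frequency_module w }.

HB.instance Definition _ (R : realType) (w : nat -> R) :=
  [isSub for @frequency_module_val R w].
HB.instance Definition _ (R : realType) (w : nat -> R) :=
  [Choice of frequency_module w by <:].
HB.instance Definition _ (R : realType) (w : nat -> R) :=
  [SubChoice_isSubZmodule of frequency_module w by <:].

Definition in_twopi_int (R : realType) : {pred R} :=
  fun x => `[< exists k : int, x = 2 * pi * k%:~R >].

Lemma in_twopi_int_zmod_closed (R : realType) : zmod_closed (@in_twopi_int R).
Proof.
split=> [|x y]; first by apply/asboolP; exists 0; rewrite mulr0.
move=> /asboolP[k ->] /asboolP[l ->].
by apply/asboolP; exists (k - l); rewrite rmorphB mulrBr.
Qed.

HB.instance Definition _ (R : realType) :=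
  GRing.isZmodClosed.Build R (@in_twopi_int R) (@in_twopi_int_zmod_closed R).

(* The factor group R / 2 pi Z, with the quotient topology. *)
Definition circle (R : realType) : Type :=
  quotient_topology (Quotient.quot (@in_twopi_int R : zmodClosed R)).

HB.instance Definition _ (R : realType) := Topological.on (circle R).
HB.instance Definition _ (R : realType) :=
  GRing.Zmodule.copy (circle R)
    (Quotient.quot (@in_twopi_int R : zmodClosed R)).

Definition to_circle (R : realType) (x : R) : circle R :=
  \pi_(Quotient.quot (@in_twopi_int R : zmodClosed R)) x.

Notation torus R := {ptws nat -> circle R}.

(* Addition of (w j * t mod 2 pi) in the group circle R;
   see kronecker_flowE for the formula in terms of representatives. *)
Definition kronecker_flow (R : realType) (w : nat -> R) (t : R)
    (theta : torus R) : torus R :=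
  fun j => theta j + to_circle (w j * t).

Lemma to_circle_eq (R : realType) (x y : R) :
  to_circle x = to_circle y <-> exists k : int, x - y = 2 * pi * k%:~R.
Proof.
pose Q := Quotient.quot (@in_twopi_int R : zmodClosed R).
have E : (x - y \in @in_twopi_int R) = (\pi_Q x == \pi_Q y).
  exact: (@Quotient.idealrBE R (@in_twopi_int R : zmodClosed R)).
split=> [h|h].
  have : x - y \in @in_twopi_int R by rewrite E; apply/eqP.
  by move/asboolP.
by apply: (@eqP _ (\pi_Q x) (\pi_Q y)); rewrite -E; apply/asboolP.
Qed.

Lemma kronecker_flowE (R : realType) (w : nat -> R) (t : R) (Theta : nat -> R) :
  kronecker_flow w t (fun j => to_circle (Theta j)) =
  (fun j => to_circle (Theta j + w j * t)).
Proof.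
by apply/funext => j; rewrite /kronecker_flow /to_circle Quotient.pi_add.
Qed.

Definition homeomorphism (X Y : topologicalType) (h : X -> Y) : Prop :=
  continuous h /\
  exists g : Y -> X, [/\ continuous g, cancel h g & cancel g h].

Definition topologically_conjugate (R : realType) (X Y : topologicalType)
    (Phi : R -> X -> X) (Psi : R -> Y -> Y) : Prop :=
  exists2 h : X -> Y, homeomorphism h &
    forall t : R, h \o Phi t = Psi t \o h.

Definition freq_supp (R : realType) (w : nat -> R) : choiceType :=
  {j : nat | w j != 0}.

Definition nonvanishing_independent (R : realType) (w : nat -> R) : Prop :=
  rationally_independent (fun j : freq_supp w => w (val j)).

(* Main.v *)
From HB Require Import structures.
Require Import Defs.
From mathcomp Require Import all_boot all_order all_algebra finmap.
From mathcomp Require Import all_classical all_reals all_analysis.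
From mathcomp Require Import ring lra zify.
From mathcomp.multinomials Require Import -(notations) monalg.

(** The frequency module is a conjugacy invariant. If h conjugates the flow of
    w to that of w', its j-th coordinate evaluated along the orbit of 0 moves
    like t |-> w' j * t modulo 2 pi, while the orbit depends on t only through
    the w k * t modulo 2 pi. Continuity of h at 0 thus makes w' j * t close to
    0 in the circle whenever finitely many w k * t are; quantitatively, there
    are C and N such that for all t

      1/2 - C * \sum_(k < N) (1 - cos (w k * t)) <= cos (w' j * t).

    Suppose w' j were not in the module of w. Multiply this inequality by a
    product P of Fejer kernels in the w k * t, which is nonnegative and has its
    spectrum in the module, and compare the means over t. On the right the
    frequency w' j cannot cancel against the spectrum of P, so the mean is 0.
    On the left, P (1 - cos (w k * t)) has a mean at most e times that of P,
    with e as small as desired, so the mean is positive. This contradiction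
    (cos_lower_bound_mem, conjugate_frequency_sub) uses neither a lifting of
    h_j to the universal cover nor Fourier analysis on the torus. Conjugacy
    being symmetric, the two modules coincide, and independence of the
    nonvanishing w' j says that they form a basis of the module.

    Conversely, sending the k-th unit vector to w k maps Z^(nat) onto the
    frequency module. When the latter is free, this surjection splits, and
    lifts of a basis of the module, together with a basis of the kernel, form
    a basis v of Z^(nat) (adapted_basis). The kernel is free because it has an
    echelon basis (kernel_free). Dually, v acts on the torus by the
    automorphism whose i-th coordinate is the character v i; it conjugates the
    flow of w to the flow whose frequencies are the images of the v i
    (basis_change_conjugate), namely zeros and basis elements. *)

Set Implicit Arguments.
Unset Strict Implicit.
Unset Printing Implicit Defensive.

Import Order.TTheory GRing.Theory Num.Theory.
Import numFieldTopology.Exports numFieldNormedType.Exports.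

Local Open Scope classical_set_scope.
Local Open Scope ring_scope.

(** * Means of bounded functions on the line *)

Section Mean.
Variable R : realType.
Implicit Types (f g F : R -> R) (a b c m : R).

(** The mean value of f, read off the linear growth of an antiderivative: for
    trigonometric polynomials the error is bounded, and no integral is needed. *)
Definition has_mean f m : Prop :=
  exists F B, (forall t : R, is_derive t (1 : R) F (f t)) /\
              (forall t : R, `|F t - m * t| <= B).

Lemma has_mean_ext f g m : (forall t, f t = g t) -> has_mean f m -> has_mean g m.
Proof. by move=> /funext ->. Qed.

Lemma has_meanD f g m n :
  has_mean f m -> has_mean g n -> has_mean (fun t => f t + g t) (m + n).
Proof.
move=> [F [B [dF bF]]] [G [C [dG bG]]]; exists (F \+ G), (B + C); split.
  by move=> t; apply: is_deriveD.
move=> t; have -> : (F \+ G) t - (m + n) * t = (F t - m * t) + (G t - n * t).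
  by rewrite /=; ring.
by rewrite (le_trans (ler_normD _ _)) ?lerD.
Qed.

Lemma has_meanZ c f m : has_mean f m -> has_mean (fun t => c * f t) (c * m).
Proof.
move=> [F [B [dF bF]]]; exists (c \*: F), (`|c| * B); split.
  by move=> t; apply: is_deriveZ.
move=> t; rewrite /= -mulrA /GRing.scale /= -mulrBr normrM.
by rewrite ler_wpM2l.
Qed.

Lemma has_mean_cst c : has_mean (fun=> c) c.
Proof.
exists (c \*: id), 0; split.
  by move=> t; apply: is_derive_eq; rewrite /GRing.scale /= mulr1.
by move=> t; rewrite /GRing.scale /= subrr normr0.
Qed.

Lemma has_mean_cos a : a != 0 -> has_mean (fun t => cos (a * t)) 0.
Proof.
move=> a0; exists (fun t => a^-1 * sin (a * t)), `|a^-1|; split.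
  move=> t; apply: is_derive_eq.
  by rewrite /GRing.scale /= ?mulr1 ?mulr0 ?addr0; field.
move=> t; rewrite mul0r subr0 normrM -[leRHS]mulr1 ler_wpM2l//.
exact: sin_max.
Qed.

(** An antiderivative of a nonnegative function is nondecreasing, so it cannot
    stay within a bounded distance of a line of negative slope. *)
Lemma has_mean_ge0 f m : (forall t, 0 <= f t) -> has_mean f m -> 0 <= m.
Proof.
move=> f0 [F [B [dF bF]]].
have Fnd t : 0 <= t -> F 0 <= F t.
  move=> t0; have [c _ E] : exists2 c, c \in `[0, t] & F t - F 0 = f c * (t - 0).
    apply: MVT_segment => //.
    apply: derivable_within_continuous => x _.
    by have [] := dF x.
  by rewrite -subr_ge0 E mulr_ge0 ?subr0.
rewrite leNgt; apply/negP => m0.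
have B0 : 0 <= B by apply: le_trans (bF 0).
pose t := (2 * B + 1) / (- m).
have t0 : 0 <= t by rewrite divr_ge0 ?oppr_ge0 ?ltW//; lra.
have mt : m * t = - (2 * B + 1) by rewrite /t; field; lra.
have := Fnd t t0; have := bF t; have := bF 0.
rewrite mulr0 subr0 mt !ler_norml; lra.
Qed.
End Mean.

(** * Cosine sums with nonnegative coefficients *)

Section CosineSum.
Variables (R : realType) (S : zmodClosed R).
Implicit Types (f g : R -> R).

(** Even trigonometric polynomials with nonnegative coefficients and spectrum
    in S. Such coefficients make means nonnegative, and they are preserved by
    products. *)
Inductive cosine_sum : (R -> R) -> Prop :=
| CosineSum0 : cosine_sum (fun=> 0)
| CosineSumD c a f : 0 <= c -> a \in S -> cosine_sum f ->
    cosine_sum (fun t => c * cos (a * t) + f t).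

Lemma cosine_sum_ext f g : (forall t, f t = g t) -> cosine_sum f -> cosine_sum g.
Proof. by move=> /funext ->. Qed.

Lemma cosine_sum_cos a : a \in S -> cosine_sum (fun t => cos (a * t)).
Proof.
move=> aS; apply: cosine_sum_ext (CosineSumD ler01 aS CosineSum0) => t.
by rewrite mul1r addr0.
Qed.

Lemma cosine_sum_add f g :
  cosine_sum f -> cosine_sum g -> cosine_sum (fun t => f t + g t).
Proof.
elim=> [|c a h c0 aS _ IH] Cg; first by apply: cosine_sum_ext Cg => t; rewrite add0r.
by apply: cosine_sum_ext (CosineSumD c0 aS (IH Cg)) => t; rewrite addrA.
Qed.

Lemma cosine_sumZ c f : 0 <= c -> cosine_sum f -> cosine_sum (fun t => c * f t).
Proof.
move=> c0; elim=> [|d a h d0 aS _ IH].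
  by apply: cosine_sum_ext CosineSum0 => t; rewrite mulr0.
apply: cosine_sum_ext (CosineSumD (mulr_ge0 c0 d0) aS IH) => t.
by rewrite mulrDr mulrA.
Qed.

Lemma cosine_sum_cst c : 0 <= c -> cosine_sum (fun=> c).
Proof.
move=> c0; apply: cosine_sum_ext (cosine_sumZ c0 (cosine_sum_cos (rpred0 S))) => t.
by rewrite mul0r cos0 mulr1.
Qed.

Lemma cosM (x y : R) : cos x * cos y = 2^-1 * (cos (x + y) + cos (x - y)).
Proof. by rewrite cosD cosB; field. Qed.

Lemma cosine_sum_mul f g :
  cosine_sum f -> cosine_sum g -> cosine_sum (fun t => f t * g t).
Proof.
elim=> [|c a h c0 aS _ IH] Cg.
  by apply: cosine_sum_ext CosineSum0 => t; rewrite mul0r.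
apply: (@cosine_sum_ext (fun t => c * (cos (a * t) * g t) + h t * g t)) => [t|].
  by rewrite mulrDl mulrA.
apply: (cosine_sum_add _ (IH Cg)); apply: cosine_sumZ => //.
elim: Cg => [|d b k d0 bS _ IHk].
  by apply: cosine_sum_ext CosineSum0 => t; rewrite mulr0.
apply: (@cosine_sum_ext (fun t => d / 2 * (cos ((a + b) * t) + cos ((a - b) * t))
  + cos (a * t) * k t)) => [t|].
  by rewrite mulrDl mulrBl [RHS]mulrDr mulrCA cosM mulrA.
apply: cosine_sum_add IHk; apply: cosine_sumZ; first by rewrite divr_ge0.
apply: cosine_sum_add; apply: cosine_sum_cos; [exact: rpredD | exact: rpredB].
Qed.

Lemma cosine_sum_mean f : cosine_sum f -> exists2 m, 0 <= m & has_mean f m.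
Proof.
elim=> [|c a h c0 aS _ [m m0 hm]]; first by exists 0 => //; apply: has_mean_cst.
have [->|a0] := eqVneq a 0; last first.
  exists (c * 0 + m); first by rewrite mulr0 add0r.
  by apply: has_meanD hm; apply: has_meanZ; apply: has_mean_cos.
exists (c + m); first exact: addr_ge0.
apply: has_meanD hm; apply: has_mean_ext (has_mean_cst c) => t.
by rewrite mul0r cos0 mulr1.
Qed.

(** The frequencies b + a and b - a that appear in the product are nonzero,
    as b would otherwise be in S. *)
Lemma cosine_sum_mean_cos f b : cosine_sum f -> b \notin S ->
  has_mean (fun t => cos (b * t) * f t) 0.
Proof.
move=> + bS; elim=> [|c a h c0 aS _ hm].
  by apply: has_mean_ext (has_mean_cst 0) => t; rewrite mulr0.
apply: (@has_mean_ext _ (fun t => c / 2 * (cos ((b + a) * t) + cos ((b - a) * t))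
  + cos (b * t) * h t)) => [t|].
  by rewrite mulrDl mulrBl [RHS]mulrDr mulrCA cosM mulrA.
rewrite -[X in has_mean _ X]addr0; apply: has_meanD hm.
rewrite -[X in has_mean _ X](mulr0 (c / 2)); apply: has_meanZ.
rewrite -[X in has_mean _ X](addr0 0); apply: has_meanD; apply: has_mean_cos.
  by apply: contra bS; rewrite addr_eq0 => /eqP ->; rewrite rpredN.
by apply: contra bS; rewrite subr_eq0 => /eqP ->.
Qed.
End CosineSum.

(** * Fejer kernels and almost invariance *)

Section Fejer.
Variable R : realType.

Fixpoint dirichlet (n : nat) (x : R) : R :=
  if n is n'.+1 then dirichlet n' x + 2 * cos (n%:R * x) else 1.

(** The kernel |\sum_(k < n) e^(ikx)|^2, without the usual factor 1 / n; the
    recursion makes (1 - cos x) * fejer n x telescope. *)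
Fixpoint fejer (n : nat) (x : R) : R :=
  if n is n'.+1 then fejer n' x + dirichlet n' x else 0.

Lemma dirichletE n x :
  (1 - cos x) * dirichlet n x = cos (n%:R * x) - cos (n.+1%:R * x).
Proof.
elim: n => [|n IH] /=; first by rewrite mul0r mul1r cos0 mulr1.
rewrite mulrDr IH.
have -> : n.+2%:R * x = n.+1%:R * x + x by rewrite -[n.+2]addn1 natrD mulrDl mul1r.
have -> : n%:R * x = n.+1%:R * x - x by rewrite -[n.+1]addn1 natrD mulrDl mul1r addrK.
by rewrite cosB cosD; ring.
Qed.

Lemma fejerE n x : (1 - cos x) * fejer n x = 1 - cos (n%:R * x).
Proof.
elim: n => [|n IH] /=; first by rewrite mul0r cos0 mulr0 subrr.
by rewrite mulrDr IH dirichletE; ring.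
Qed.

(** Where cos x < 1, the closed form of fejerE gives the sign; elsewhere x is
    a multiple of 2 pi and every cosine in the kernel is 1. *)
Lemma fejer_ge0 n x : 0 <= fejer n x.
Proof.
have [c1|c1] := ltP (cos x) 1.
  rewrite -(@pmulr_rge0 _ (1 - cos x)) ?subr_gt0// fejerE subr_ge0.
  exact: cos_le1.
have cE : cos x = 1 by apply/eqP; rewrite eq_le cos_le1.
have sE : sin x = 0 by apply: cos1sin0; rewrite cE normr1.
have ck k : cos (k%:R * x) = 1.
  elim: k => [|k IH]; first by rewrite mul0r cos0.
  by rewrite -addn1 natrD mulrDl mul1r cosD IH cE sE !mulr0 subr0 mulr1.
have d0 k : 0 <= dirichlet k x by elim: k => //= k IH; rewrite ck; lra.
by elim: n => //= n IH; rewrite addr_ge0.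
Qed.

Lemma fejer_cosine_sum (S : zmodClosed R) n a : a \in S ->
  exists2 H, cosine_sum S H & forall t, fejer n (a * t) = n%:R + H t.
Proof.
move=> aS.
have D k : exists2 H, cosine_sum S H & forall t, dirichlet k (a * t) = 1 + H t.
  elim: k => [|k [H CH E]] /=.
    by exists (fun=> 0) => [|t]; [exact: CosineSum0 | rewrite addr0].
  exists (fun t => H t + 2 * cos (k.+1%:R * a * t)) => [|t].
    apply: cosine_sum_add CH _; apply: cosine_sumZ => //; apply: cosine_sum_cos.
    by rewrite mulr_natl rpredMn.
  by rewrite E addrA mulrA.
elim: n => [|n [H CH E]] /=.
  by exists (fun=> 0) => [|t]; [exact: CosineSum0 | rewrite addr0].
have [H' CH' E'] := D n.
exists (fun t => H t + H' t) => [|t]; first exact: cosine_sum_add.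
by rewrite E E' -[n.+1]addn1 natrD; ring.
Qed.

(** A product of Fejer kernels, one for each of the first N frequencies, is
    almost invariant: multiplying it by 1 - cos (w k * t) collapses the k-th
    factor to (1 - cos ((n + 1) * w k * t)) / (n + 1). Since the k-th factor
    itself has constant term 1, the result is P / (n + 1) up to subtracting a
    cosine sum, whose mean is nonnegative. This is the Folner property of the
    group generated by the frequencies. *)
Lemma almost_invariant_cosine_sum (S : zmodClosed R) (w : nat -> R) (n N : nat) :
  (forall k, w k \in S) ->
  exists P : R -> R, exists H : R -> R,
    [/\ forall t, 0 <= P t, cosine_sum S H, forall t, P t = 1 + H t &
     forall k, (k < N)%N -> exists2 E, cosine_sum S E &
       forall t, (1 - cos (w k * t)) * P t = n.+1%:R^-1 * P t - E t].
Proof.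
move=> wS; elim: N => [|N [P [H [P0 CH PE inv]]]].
  exists (fun=> 1), (fun=> 0); split=> // [|t]; first exact: CosineSum0.
  by rewrite addr0.
have n0 : 0 <= n.+1%:R^-1 :> R by rewrite invr_ge0.
have CP : cosine_sum S P.
  apply: cosine_sum_ext (cosine_sum_add (cosine_sum_cst S ler01) CH) => t.
  by rewrite PE.
have [K CK KE] := fejer_cosine_sum n.+1 (wS N).
pose L t := n.+1%:R^-1 * K t.
have CL : cosine_sum S L by exact: cosine_sumZ.
pose F t := n.+1%:R^-1 * fejer n.+1 (w N * t).
have FE t : F t = 1 + L t by rewrite /F KE mulrDr mulVf ?pnatr_eq0.
have CF : cosine_sum S F.
  apply: cosine_sum_ext (cosine_sum_add (cosine_sum_cst S ler01) CL) => t.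
  by rewrite FE.
exists (fun t => P t * F t), (fun t => H t + P t * L t); split.
- by move=> t; rewrite !mulr_ge0 ?fejer_ge0.
- by apply: cosine_sum_add CH _; apply: cosine_sum_mul.
- by move=> t; rewrite FE mulrDr mulr1 {1}PE addrA.
move=> k; rewrite ltnS leq_eqVlt => /predU1P[->|kN]; last first.
  have [E CE EE] := inv k kN.
  exists (fun t => E t * F t) => [|t]; first exact: cosine_sum_mul.
  by rewrite mulrA EE; ring.
exists (fun t => n.+1%:R^-1 * (P t * L t + P t * cos (n.+1%:R * w N * t))) => [|t].
  apply: cosine_sumZ => //; apply: cosine_sum_add; apply: cosine_sum_mul => //.
  by apply: cosine_sum_cos; rewrite mulr_natl rpredMn.
have -> : (1 - cos (w N * t)) * (P t * F t) =
    n.+1%:R^-1 * P t * (1 - cos (n.+1%:R * (w N * t))).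
  by rewrite -fejerE /F; ring.
by rewrite FE mulrA; ring.
Qed.

(** Integrating the lower bound against an almost invariant P: if b is not in
    S, the right-hand side has mean 0, whereas the left-hand side has a mean
    of at least a quarter of that of P, which is positive. *)
Lemma cos_lower_bound_mem (S : zmodClosed R) (w : nat -> R) (b : R) (C N : nat) :
  (forall k, w k \in S) ->
  (forall t, 2^-1 - C%:R * \sum_(k < N) (1 - cos (w k * t)) <= cos (b * t)) ->
  b \in S.
Proof.
move=> wS lb; apply/negPn/negP => bS.
have [P [H [P0 CH PE inv]]] := almost_invariant_cosine_sum (4 * (C * N)) N wS.
pose e : R := (4 * (C * N)).+1%:R^-1.
have [E CE EE] : exists2 E, cosine_sum S E & forall t,
    \sum_(k < N) (1 - cos (w k * t)) * P t = N%:R * (e * P t) - E t.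
  elim: {-2}N (leqnn N) => [_|k IH kN].
    exists (fun=> 0) => [|t]; first exact: CosineSum0.
    by rewrite big_ord0 mul0r subrr.
  have [E CE EE] := IH (ltnW kN); have [G CG GE] := inv k kN.
  exists (fun t => E t + G t) => [|t]; first exact: cosine_sum_add.
  by rewrite big_ord_recr /= EE GE -/e -natr1; ring.
(* The N errors, each amplified by C, must stay below half of the term
   2^-1 * P; this dictates the order 4 * (C * N) of the kernels. *)
have CN : C%:R * (N%:R * e) <= 4^-1 :> R.
  have nE : (4 * (C * N)).+1%:R = 4 * (C%:R * N%:R) + 1 :> R.
    by rewrite -[in LHS]natr1 !natrM.
  by rewrite mulrA /e ler_pdivrMr ?ltr0Sn// nE; lra.
have [mH mH0 hH] := cosine_sum_mean CH.
have [mE mE0 hE] := cosine_sum_mean CE.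
have hP : has_mean P (1 + mH).
  by apply: has_mean_ext (has_meanD (has_mean_cst 1) hH) => t; rewrite PE.
have CP : cosine_sum S P.
  apply: cosine_sum_ext (cosine_sum_add (cosine_sum_cst S ler01) CH) => t.
  by rewrite PE.
have hbP := cosine_sum_mean_cos CP bS.
have := has_meanD hbP (has_meanD (has_meanZ (- 4^-1) hP) (has_meanZ (- C%:R) hE)).
have C0 : 0 <= C%:R * mE by rewrite mulr_ge0.
move=> /has_mean_ge0 h; suff : 0 <= 0 + (- 4^-1 * (1 + mH) + - C%:R * mE) by lra.
apply: h => t.
have := ler_wpM2r (P0 t) (lb t).
rewrite mulrBl -mulrA mulr_suml EE => lbP.
have : C%:R * (N%:R * e) * P t <= 4^-1 * P t by apply: ler_wpM2r.
move: lbP; rewrite mulrBr !mulrA; lra.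
Qed.
End Fejer.

(** * The circle and the torus *)

Section Circle.
Variable R : realType.
Implicit Types (x y : R) (u v : circle R).

Lemma to_circle_continuous : continuous (@to_circle R).
Proof. exact: pi_continuous. Qed.

Lemma to_circle_surj u : exists x, to_circle x = u.
Proof.
exists (repr (u : Quotient.quot (@in_twopi_int R : zmodClosed R))).
exact: reprK.
Qed.

Lemma to_circleD x y : to_circle (x + y) = to_circle x + to_circle y.
Proof. by rewrite /to_circle Quotient.pi_add. Qed.

Lemma to_circleN x : to_circle (- x) = - to_circle x.
Proof. by rewrite /to_circle Quotient.pi_opp. Qed.

Lemma to_circle0 : to_circle (0 : R) = 0.
Proof. by apply: (addrI (to_circle 0)); rewrite -to_circleD !addr0. Qed.

Lemma to_circleB x y : to_circle (x - y) = to_circle x - to_circle y.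
Proof. by rewrite to_circleD to_circleN. Qed.

(** The saturation of an open set is the union of its translates by the
    multiples of 2 pi. *)
Lemma to_circle_open (A : set R) : open A -> open (@to_circle R @` A).
Proof.
move=> oA; rewrite /open /= /quotient_open.
rewrite (_ : _ @^-1` _ =
  \bigcup_(k in [set: int]) ((fun x => x + 2 * pi * k%:~R) @^-1` A)).
  apply: bigcup_open => k _; apply: open_comp => // x _.
  by apply: cvgD; [exact: cvg_id | exact: cvg_cst].
apply/seteqP; split=> [x [a Aa /to_circle_eq[k ak]]|x [k _ Ax]].
  by exists k => //=; rewrite -ak addrC subrK.
exists (x + 2 * pi * k%:~R) => //; apply/to_circle_eq; exists k.
by rewrite addrAC subrr add0r.
Qed.

(** The topology of circle R * circle R is not given as a quotient of R * R:
    openness of the projection is what carries product neighbourhoods over. *)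
Lemma circle_add_continuous :
  continuous (fun p : circle R * circle R => p.1 + p.2).
Proof.
move=> [u v]; have [x <-] := to_circle_surj u; have [y <-] := to_circle_surj v.
rewrite /continuous_at /= -to_circleD => U /= /(@to_circle_continuous (x + y)) /= nU.
have nU' : nbhs (x, y) [set p : R * R | U (to_circle (p.1 + p.2))].
  exact: (@add_continuous R^o (x, y) _ nU).
have [[A B] /= [nA nB] AB] := nU'.
have nbhs_img z V : nbhs z V -> nbhs (to_circle z) (@to_circle R @` V).
  rewrite nbhsE => -[W [oW Wz] WV].
  rewrite nbhsE; exists (@to_circle R @` W); last exact: image_subset.
  by split; [exact: to_circle_open | exists z].
exists (@to_circle R @` A, @to_circle R @` B) => /=.
  by split; exact: nbhs_img.
move=> [_ _] [/= [a Aa <-] [b Bb <-]].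
by rewrite -to_circleD; exact: (AB (a, b)).
Qed.

Lemma circle_opp_continuous : continuous (fun u : circle R => - u).
Proof.
apply/(@quotient_continuous _ (Quotient.quot (@in_twopi_int R : zmodClosed R))).
rewrite (_ : _ \o _ = @to_circle R \o -%R).
  move=> x; apply: continuous_comp; first exact: opp_continuous.
  exact: to_circle_continuous.
by apply/funext => x /=; rewrite to_circleN.
Qed.

Lemma cosD2pi_int x (k : int) : cos (x + 2 * pi * k%:~R) = cos x.
Proof.
have per n y : cos (y + 2 * pi * n%:R) = cos y.
  by rewrite mulr_natr mulr_natl; apply: periodicn; exact: cosD2pi.
case: k => n; first exact: per.
by rewrite NegzE mulrNz mulrN -[in RHS](subrK (2 * pi * n.+1%:R) x) per.
Qed.

(** After reduction modulo 2 pi to the interval [- pi, pi], the distance to 0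
    is controlled by the cosine, which is decreasing on [0, pi]. *)
Lemma cvg_to_circle0 (x : nat -> R) :
  cos (x n) @[n --> \oo] --> (1 : R) ->
  to_circle (x n) @[n --> \oo] --> (0 : circle R).
Proof.
move=> cx U; rewrite -to_circle0.
move=> /(@to_circle_continuous 0) /= /nbhs_ballP[e /= e0 eU].
pose r := Num.min e 1.
have r0 : 0 < r by rewrite lt_min e0 ltr01.
have r1 : r <= 1 by rewrite ge_min lexx orbT.
have pi2 := pi_ge2 R.
have cr : cos r < 1.
  by rewrite -cos0 ltr_cos// in_itv/= ?lexx ?pi_ge0// ltW//=; lra.
have : \forall n \near \oo, cos r < cos (x n) by exact: (cvgr_gt 1).
apply: filterS => n crx /=.
pose k := Num.floor ((x n + pi) / (2 * pi)).
pose y := x n - 2 * pi * k%:~R.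
have p2 : 0 < 2 * pi :> R by lra.
have yE : x n = y + 2 * pi * k%:~R by rewrite /y subrK.
have yb : - pi <= y <= pi.
  have /andP[k1 k2] := floor_itv ((x n + pi) / (2 * pi)).
  move: k1 k2; rewrite -/k ler_pdivlMr// ltr_pdivrMr// yE mulrDl mul1r.
  by rewrite mulrC => k1 k2; apply/andP; split; lra.
rewrite yE (_ : to_circle _ = to_circle y); last first.
  by apply/to_circle_eq; exists k; rewrite addrAC subrr add0r.
apply: eU; rewrite /ball /= sub0r normrN.
move: crx; rewrite yE cosD2pi_int -(cos_norm y).
rewrite ltr_cos ?in_itv/= ?normr_ge0 ?ler_norml//.
  by move=> /lt_le_trans -> //; rewrite /r ge_min lexx.
by rewrite ltW//=; lra.
Qed.

End Circle.

(** * Invariance of the frequency module under conjugacy *)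

Section Invariance.
Variable R : realType.

Lemma cvg_torus (T : Type) (F : set_system T) (FF : Filter F)
    (f : T -> torus R) (l : torus R) :
  (forall j, f x j @[x --> F] --> l j) -> f @ F --> l.
Proof.
move=> fl; apply/cvg_sup => j U [V [[W oW <-] Wl] WU].
apply: filterS WU _; apply: (fl j); rewrite nbhsE; exists W => //.
Qed.

(** The cosine of the distance to a fixed point of the circle separates that
    point from the others by a real-valued continuous function. *)
Lemma circle_cos (c : R) : exists2 f : circle R -> R,
  continuous f & forall x, f (to_circle x) = cos (x - c).
Proof.
pose g (x : R) := cos (x - c).
have gE (x y : R) : to_circle x = to_circle y -> g x = g y.
  move=> /to_circle_eq[k xy]; rewrite /g -[x](subrK y) xy [_ + y]addrC addrAC.
  exact: cosD2pi_int.
pose Q := Quotient.quot (@in_twopi_int R : zmodClosed R).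
exists (fun u : circle R => g (repr (u : Q))) => [|x]; last first.
  by apply: gE; exact: reprK.
apply: (@repr_comp_continuous _ Q _ g) => [x|x y /eqP /gE ->//].
apply: (@continuous_comp _ _ _ (fun x => x - c) cos); last exact: continuous_cos.
by apply: cvgB; [exact: cvg_id | exact: cvg_cst].
Qed.

Lemma mem_frequency (w : nat -> R) k : w k \in in_frequency_module w.
Proof.
apply/asboolP; exists (mkmalgU k 1).
by rewrite (int_comb_dom w msuppU_le) big_seq_fset1 mcoeffUU mulr1.
Qed.

(** If no C and N gave the lower bound of cos_lower_bound_mem, taking C = N = n
    would produce times t n along which every w k * t n tends to 0 in the
    circle, so that the orbit of 0 comes back to its start, while w' j * t n
    stays away from 0. This contradicts the continuity of h. *)
Lemma conjugate_frequency_sub (w w' : nat -> R) :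
  topologically_conjugate (kronecker_flow w) (kronecker_flow w') ->
  forall j, w' j \in in_frequency_module w.
Proof.
move=> [h [hc _] hflow] j.
pose th t : torus R := fun k => to_circle (w k * t).
have hE t : h (th t) j = h (th 0) j + to_circle (w' j * t).
  transitivity ((h \o kronecker_flow w t) (th 0) j); last by rewrite hflow.
  congr (h _ j); apply/funext => k.
  by rewrite /kronecker_flow /th -to_circleD mulr0 add0r.
suff [C [N lb]] : exists C N : nat, forall t,
    2^-1 - C%:R * \sum_(k < N) (1 - cos (w k * t)) <= cos (w' j * t).
  exact: (cos_lower_bound_mem (S := in_frequency_module w) (@mem_frequency w) lb).
apply: contrapT => nlb.
have ex n : exists t, cos (w' j * t) < 2^-1 - n%:R * \sum_(k < n) (1 - cos (w k * t)).
  apply: contrapT => nt; apply: nlb; exists n, n => t.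
  by rewrite leNgt; apply/negP => ct; apply: nt; exists t.
have [t tP] := choice ex.
have cos1 k (x : R) : 0 <= 1 - cos (w k * x) by rewrite subr_ge0 cos_le1.
have cvg_th : th (t n) @[n --> \oo] --> th 0.
  apply: cvg_torus => k; rewrite /th mulr0 to_circle0.
  apply: cvg_to_circle0.
  apply/cvgrPdist_lt => e e0; near=> n.
  rewrite ger0_norm ?cos1//.
  have kn : (k < n)%N by near: n; exact: nbhs_infty_gt.
  have le_sum : 1 - cos (w k * t n) <= \sum_(i < n) (1 - cos (w i * t n)).
    by rewrite (bigD1 (Ordinal kn))//= lerDl sumr_ge0.
  have n0 : 0 < n%:R :> R by rewrite ltr0n (leq_ltn_trans _ kn).
  have en : 2 < e * n%:R.
    rewrite -ltr_pdivrMl// mulrC; near: n; exact: nbhs_infty_gtr.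
  have := tP n; have := cos_geN1 (w' j * t n).
  have := ler_wpM2l (ltW n0) le_sum; set x := 1 - _ => h1 h2 h3.
  have : n%:R * x < n%:R * e by lra.
  by rewrite ltr_pM2l.
have [c hc0] := to_circle_surj (h (th 0) j).
have [f fc fE] := circle_cos c.
have cvg1 : cos (w' j * t n) @[n --> \oo] --> (1 : R).
  have -> : (fun n => cos (w' j * t n)) = (fun n => f (h (th (t n)) j)).
    by apply/funext => n; rewrite hE -hc0 -to_circleD fE addrAC subrr add0r.
  have -> : (1 : R) = f (h (th 0) j) by rewrite -hc0 fE subrr cos0.
  apply: continuous_cvg; first exact: fc.
  apply: (@cvg_comp _ _ _ (fun n => h (th (t n)))
    (@proj nat (fun=> circle R) j) _ (nbhs (h (th 0)))).
    by apply: continuous_cvg; [exact: hc | exact: cvg_th].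
  exact: (@proj_continuous nat (fun=> circle R)).
have : \forall n \near \oo, 2^-1 < cos (w' j * t n).
  by apply: (cvgr_gt 1) => //; lra.
move=> [n _ /(_ n (leqnn n)) /= nh]; have := tP n.
suff : 0 <= n%:R * \sum_(k < n) (1 - cos (w k * t n)) by lra.
by rewrite mulr_ge0// sumr_ge0.
Unshelve. all: by end_near.
Qed.
End Invariance.

(** * Free abelian groups *)

Lemma inj_surj_bij (A B : Type) (f : A -> B) :
  injective f -> (forall y, exists x, f x = y) -> bijective f.
Proof.
move=> f_inj /choice[g gK]; exists g => // x.
by apply: f_inj; rewrite gK.
Qed.

Section FreeGroup.
Variable J : choiceType.
Implicit Types (G H : zmodType) (nu mu : Zfs J).

Definition unit_vec (j : J) : Zfs J := mkmalgU j 1.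

Lemma mcoeff_unit_vec j k : mcoeff k (unit_vec j) = (j == k)%:R.
Proof. by rewrite /unit_vec mcoeffU. Qed.

(** The homomorphism from Z^(J) to G that extends x: the universal property of
    the free group. A family x is a basis of G when fsum x is bijective. *)
Definition fsum G (x : J -> G) (nu : Zfs J) : G :=
  \sum_(j <- msupp nu) x j *~ mcoeff j nu.

Lemma fsum_dom G (x : J -> G) nu (A : {fset J}) :
  (msupp nu `<=` A)%fset -> fsum x nu = \sum_(j <- A) x j *~ mcoeff j nu.
Proof.
move=> sA; rewrite /fsum; apply: big_fset_incl => // j _.
by rewrite -mcoeff_eq0 => /eqP ->; rewrite mulr0z.
Qed.

Fact fsum_is_zmod_morphism G (x : J -> G) : zmod_morphism (fsum x).
Proof.
move=> nu mu; pose A := (msupp nu `|` msupp mu)%fset.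
rewrite !(@fsum_dom _ x _ A) ?fsubsetUl ?fsubsetUr ?msuppB_le//.
by rewrite -sumrB; apply: eq_bigr => j _; rewrite mcoeffB mulrzBr.
Qed.
HB.instance Definition _ G (x : J -> G) :=
  GRing.isZmodMorphism.Build (Zfs J) G (fsum x) (@fsum_is_zmod_morphism G x).

Lemma fsum_unit_vec G (x : J -> G) j : fsum x (unit_vec j) = x j.
Proof.
by rewrite (@fsum_dom _ x _ [fset j]%fset) ?msuppU_le// big_seq_fset1 mcoeffUU.
Qed.

Lemma fsum_morph G H (f : {additive G -> H}) (x : J -> G) nu :
  f (fsum x nu) = fsum (f \o x) nu.
Proof. by rewrite /fsum raddf_sum; apply: eq_bigr => j _; rewrite raddfMz. Qed.

Lemma fsumD G (x y : J -> G) nu : fsum (x \+ y) nu = fsum x nu + fsum y nu.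
Proof. by rewrite /fsum -big_split; apply: eq_bigr => j _; rewrite /= mulrzDl. Qed.

Lemma unit_vec_fsum nu : fsum unit_vec nu = nu.
Proof.
rewrite [RHS]monalgE; apply: eq_bigr => j _.
by rewrite /unit_vec -raddfMz /= mulrzz mul1r.
Qed.

Lemma additive_fsum G (f : {additive Zfs J -> G}) nu :
  f nu = fsum (f \o unit_vec) nu.
Proof. by rewrite -fsum_morph unit_vec_fsum. Qed.

Lemma eq_fsum G (x y : J -> G) nu : x =1 y -> fsum x nu = fsum y nu.
Proof. by move=> /funext ->. Qed.

Lemma fsum_inj G (x : J -> G) :
  (forall nu, fsum x nu = 0 -> nu = 0) -> injective (fsum x).
Proof. by move=> h nu mu /eqP; rewrite -subr_eq0 -raddfB => /eqP/h/subr0_eq. Qed.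
End FreeGroup.

Lemma mcoeff_fsum (J K : choiceType) (x : J -> Zfs K) (nu : Zfs J) k :
  mcoeff k (fsum x nu) = fsum (fun j => mcoeff k (x j)) nu.
Proof. exact: fsum_morph. Qed.

Lemma fsum_fsum (J K : choiceType) (G : zmodType) (x : K -> G) (y : J -> Zfs K) nu :
  fsum x (fsum y nu) = fsum (fun j => fsum x (y j)) nu.
Proof. exact: fsum_morph. Qed.

Lemma fsum_int_single (J : choiceType) (x : J -> int) (nu : Zfs J) j :
  (forall i, i != j -> x i * mcoeff i nu = 0) -> fsum x nu = x j * mcoeff j nu.
Proof.
move=> x0; rewrite (@fsum_dom _ _ x nu (j |` msupp nu)%fset) ?fsubsetUr//.
rewrite (big_fsetD1 j) ?fset1U1//= mulrzz big_seq big1 ?addr0// => i.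
by rewrite !inE => /andP[ij _]; rewrite mulrzz x0.
Qed.

Lemma mcoeff_fsum_inj (J K : choiceType) (e : J -> K) (nu : Zfs J) j :
  injective e -> mcoeff (e j) (fsum (fun i => unit_vec (e i)) nu) = mcoeff j nu.
Proof.
move=> e_inj; rewrite mcoeff_fsum (fsum_int_single (j := j)).
  by rewrite mcoeff_unit_vec eqxx mul1r.
by move=> i ij; rewrite mcoeff_unit_vec (inj_eq e_inj) (negPf ij) mul0r.
Qed.

(** * Subgroups and adapted bases of Z^(nat) *)

Section Kernel.
Variables (G : zmodType) (phi : {additive Zfs nat -> G}).

Definition below (n : nat) (nu : Zfs nat) := forall k, (n <= k)%N -> mcoeff k nu = 0.

Lemma below_ex nu : exists n, below n nu.
Proof.
exists (\max_(k <- msupp nu) k).+1 => k lt_k; apply/eqP; rewrite mcoeff_eq0.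
apply/negP => kin; move: lt_k; rewrite ltnNge => /negP; apply.
by rewrite (big_fsetD1 k)//= leq_maxl.
Qed.

(** The leading positions of the elements of the kernel, that is the pivots of
    its echelon form. *)
Definition pivot : choiceType := {n : nat | `[< exists x,
  [/\ phi x = 0, below n.+1 x & mcoeff n x != 0] >]}.

(** The leading coefficients at a given pivot, together with 0, form a subgroup
    of the integers; one of least absolute value divides all others. *)
Lemma pivot_vec (n : pivot) : exists b,
  [/\ phi b = 0, below (val n).+1 b, mcoeff (val n) b != 0 &
   forall x, phi x = 0 -> below (val n).+1 x ->
     (mcoeff (val n) b %| mcoeff (val n) x)%Z].
Proof.
case: n => n /= /asboolP[x0 [px0 bx0 x0n]].
pose P d := `[< exists x, [/\ phi x = 0, below n.+1 x, mcoeff n x != 0 &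
  `|mcoeff n x|%N = d] >].
have exP : exists d, P d by exists `|mcoeff n x0|%N; apply/asboolP; exists x0.
case: (ex_minnP exP) => d /asboolP[b [pb bb bn <-]] dmin.
exists b; split=> // x px bx; apply/dvdz_mod0P.
set q := (mcoeff n x %/ mcoeff n b)%Z.
have xq : mcoeff n (x - b *~ q) = (mcoeff n x %% mcoeff n b)%Z.
  by rewrite mcoeffB raddfMz /= mulrzz /modz mulrC.
apply/eqP/negPn/negP => r0.
have : (`|mcoeff n b| <= `|(mcoeff n x %% mcoeff n b)%Z|)%N.
  apply: dmin; apply/asboolP; exists (x - b *~ q); split; rewrite ?xq//.
    by rewrite raddfB raddfMz px pb mul0rz subrr.
  by move=> k nk; rewrite mcoeffB raddfMz /= bx// bb// mul0rz subrr.
by rewrite leqNgt => /negP; apply; have := modz_ge0 (mcoeff n x) bn;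
  have := ltz_mod (mcoeff n x) bn; lia.
Qed.

(** A subgroup of Z^(nat) is free: one vector per pivot, chosen by pivot_vec,
    gives an echelon family. It is independent because the top coefficient of a
    combination comes from a single vector, and it spans because subtracting a
    multiple of the vector at the top position shortens any element. *)
Lemma kernel_free : exists (J : choiceType) (b : J -> Zfs nat),
  injective (fsum b) /\
  forall x, phi x = 0 <-> exists nu, x = fsum b nu.
Proof.
have [b bP] := choice pivot_vec.
exists pivot, b; split.
  apply: fsum_inj => nu b0; apply/malgP => j; rewrite mcoeff0.
  have [N Nb] : exists N, forall i : pivot, (N <= val i)%N -> mcoeff i nu = 0.
    have [N NP] := below_ex (fsum (fun i => unit_vec (val i)) nu).
    by exists N => i Ni; rewrite -(NP (val i) Ni) mcoeff_fsum_inj//; exact: val_inj.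
  elim: N j Nb => [|N IH] j Nb; first exact: Nb.
  apply: IH => i; rewrite leq_eqVlt => /predU1P[iN|]; last exact: Nb.
  have /(congr1 (mcoeff N)) := b0; rewrite mcoeff0 mcoeff_fsum.
  have [_ _ bi _] := bP i.
  rewrite (fsum_int_single (j := i)).
    by rewrite iN => /eqP; rewrite mulf_eq0 (negPf bi) => /eqP.
  move=> k ki; have [Nk|kN] := ltnP N (val k); first by rewrite (Nb k) ?mulr0.
  have [_ bk _ _] := bP k; rewrite bk ?mul0r// ltn_neqAle kN andbT.
  by apply: contra ki => /eqP kN'; apply/eqP/val_inj; rewrite kN'.
move=> x; split=> [|[nu ->]]; last first.
  rewrite fsum_morph (@eq_fsum _ _ _ (fun=> 0)); last first.
    by move=> j; have [/= -> _ _ _] := bP j.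
  by rewrite /fsum big1// => j _; rewrite mul0rz.
have [N] := below_ex x; elim: N x => [|N IH] x xN px.
  by exists 0; rewrite raddf0; apply/malgP => k; rewrite xN// mcoeff0.
have [x0|x0] := eqVneq (mcoeff N x) 0.
  by apply: IH => // k; rewrite leq_eqVlt => /predU1P[<-//|]; exact: xN.
have NP : `[< exists x, [/\ phi x = 0, below N.+1 x & mcoeff N x != 0] >].
  by apply/asboolP; exists x.
pose i : pivot := exist _ N NP.
have [pb bb _ /(_ x px xN) /dvdzP[q qE]] := bP i.
have [k Nk||nu nuE] := IH (x - b i *~ q).
- rewrite mcoeffB raddfMz /= mulrzz.
  move: Nk; rewrite leq_eqVlt => /predU1P[<-|Nk].
    by rewrite qE mulrC subrr.
  by rewrite xN// bb// mul0r subrr.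
- by rewrite raddfB raddfMz px pb mul0rz subrr.
exists (nu + unit_vec i *~ q).
by rewrite raddfD raddfMz /= fsum_unit_vec -nuE subrK.
Qed.

End Kernel.

(** Finitely many vectors involve only finitely many coordinates, hence cannot
    span; distinct basis vectors are distinct elements of a countable group. *)
Lemma basis_index_nat (T : choiceType) (v : T -> Zfs nat) :
  bijective (fsum v) -> exists e : nat -> T, bijective e.
Proof.
move=> bv; have v_inj : injective v.
  move=> s t st; have /(bij_inj bv)/(congr1 (mcoeff s)) :
    fsum v (unit_vec s) = fsum v (unit_vec t) by rewrite !fsum_unit_vec.
  by rewrite !mcoeff_unit_vec eqxx; case: eqP => // ->.
have infT : infinite_set [set: T].
  move=> /finite_fsetP[A AE].
  have /choice[n nP] := fun t => below_ex (v t).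
  pose N := \max_(t <- A) n t.
  have [g gK Kg] := bv; have := Kg (unit_vec N).
  move=> /(congr1 (mcoeff N)); rewrite mcoeff_unit_vec eqxx mcoeff_fsum.
  rewrite (@eq_fsum _ _ _ (fun=> 0)) => [|t].
    by rewrite /fsum big1// => j _; rewrite mul0rz.
  have tA : t \in A by have : [set` A] t by rewrite -AE.
  by apply: nP; rewrite /N (big_fsetD1 t)//= leq_maxl.
have cT : countable [set: T].
  pose code (t : T) := [seq (k, mcoeff k (v t)) | k <- msupp (v t)].
  apply/countable_injP; exists (choice.pickle \o code) => s t _ _ /=.
  move=> /(pcan_inj choice.pickleK) st; apply: v_inj; apply/malgP => k.
  have cE u : mcoeff k (v u) != 0 <-> (k, mcoeff k (v u)) \in code u.
    rewrite mcoeff_neq0; split=> [ku|/mapP[l lu [-> _]]//].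
    by apply/mapP; exists k.
  have cI u z : (k, z) \in code u -> z = mcoeff k (v u) by move=> /mapP[l _ [-> ->]].
  have [s0|/cE] := eqVneq (mcoeff k (v s)) 0; last by rewrite st => /cI.
  have [t0|/cE] := eqVneq (mcoeff k (v t)) 0; first by rewrite s0 t0.
  by rewrite -st => /cI.
have /card_set_bijP[f] := eq_card_nat cT infT.
by rewrite setTT_bijective => -[e fK eK]; exists e, f.
Qed.

(** A surjection phi onto a free group splits, so that a basis of its kernel
    together with lifts of a basis of its image is a basis of the source. The
    second clause is the independence of the nonzero images phi (v i), in a
    form that is stable under reindexing. *)
Lemma adapted_basis (G : zmodType) (phi : {additive Zfs nat -> G}) :
  (forall y, exists x, phi x = y) -> free_abelian G ->
  exists v : nat -> Zfs nat, bijective (fsum v) /\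
    forall mu, phi (fsum v mu) = 0 ->
      forall i, phi (v i) != 0 -> mcoeff i mu = 0.
Proof.
move=> phi_surj [J' [f [g fK gK]]].
have [J [b [b_inj kerP]]] := kernel_free phi.
have /choice[c cP] := fun j => phi_surj (g (unit_vec j)).
have f_phi nu : f (phi (fsum c nu)) = nu.
  rewrite !fsum_morph -[RHS]unit_vec_fsum; apply: eq_fsum => j /=.
  by rewrite cP gK.
pose T : choiceType := (J + J')%type.
pose v (t : T) := match t with inl j => b j | inr j => c j end.
pose pl (t : T) : Zfs J := match t with inl j => unit_vec j | inr _ => 0 end.
pose pr (t : T) : Zfs J' := match t with inl _ => 0 | inr j => unit_vec j end.
have vE nu : fsum v nu = fsum b (fsum pl nu) + fsum c (fsum pr nu).
  rewrite !fsum_fsum -fsumD; apply: eq_fsum => -[j|j] /=;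
  by rewrite fsum_unit_vec raddf0 ?addr0 ?add0r.
have vl j : fsum v (unit_vec (inl j : T)) = b j by exact: fsum_unit_vec.
have vr j : fsum v (unit_vec (inr j : T)) = c j by exact: fsum_unit_vec.
have phib nu : phi (fsum b nu) = 0 by apply/kerP; exists nu.
have f_phi_v nu : f (phi (fsum v nu)) = fsum pr nu.
  by rewrite vE raddfD phib add0r f_phi.
have v_bij : bijective (fsum v).
  have v_inj : injective (fsum v).
    apply: fsum_inj => nu v0.
    have pr0 : fsum pr nu = 0 by rewrite -f_phi_v v0 !raddf0.
    have pl0 : fsum pl nu = 0.
      by apply: b_inj; rewrite raddf0; move: v0; rewrite vE pr0 raddf0 addr0.
    rewrite -[LHS]unit_vec_fsum.
    transitivity (fsum (fun j => unit_vec (inl j : T)) (fsum pl nu) +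
                  fsum (fun j => unit_vec (inr j : T)) (fsum pr nu)).
      rewrite !fsum_fsum -fsumD; apply: eq_fsum => -[j|j] /=;
      by rewrite fsum_unit_vec raddf0 ?addr0 ?add0r.
    by rewrite pr0 pl0 !raddf0 addr0.
  apply: inj_surj_bij => // x.
  have /kerP[nu nuE] : phi (x - fsum c (f (phi x))) = 0.
    by rewrite raddfB; apply: (can_inj fK); rewrite raddfB f_phi subrr raddf0.
  exists (fsum (fun j => unit_vec (inl j : T)) nu +
          fsum (fun j => unit_vec (inr j : T)) (f (phi x))).
  rewrite raddfD -[RHS](subrK (fsum c (f (phi x)))) nuE.
  rewrite [X in X + _]fsum_fsum [X in _ + X = _]fsum_fsum.
  by rewrite (eq_fsum _ vl) (eq_fsum _ vr).
have [e be] := basis_index_nat v_bij; have [e' eK e'K] := be.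
exists (v \o e).
have veE mu : fsum (v \o e) mu = fsum v (fsum (fun i => unit_vec (e i)) mu).
  by rewrite fsum_fsum; apply: eq_fsum => i; rewrite fsum_unit_vec.
split=> [|mu /(congr1 f)].
  rewrite (_ : fsum (v \o e) = fsum v \o fsum (fun i => unit_vec (e i))).
    apply: bij_comp v_bij _.
    by exists (fsum (fun t => unit_vec (e' t))) => nu; rewrite fsum_fsum
      -[RHS]unit_vec_fsum; apply: eq_fsum => i; rewrite fsum_unit_vec ?eK ?e'K.
  by apply/funext => mu; rewrite veE.
rewrite veE f_phi_v raddf0 => pr0 i /= phi0.
rewrite -(mcoeff_fsum_inj mu i (bij_inj be)).
set nu := fsum _ mu in pr0 *.
case: (e i) phi0 => [j|j _] /=.
  by rewrite -(fsum_unit_vec b j) phib eqxx.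
have := congr1 (mcoeff j) pr0; rewrite mcoeff0 mcoeff_fsum.
rewrite (fsum_int_single (j := inr j : T)) /=.
  by rewrite mcoeff_unit_vec eqxx mul1r.
case=> [k _|k kj]; first by rewrite mcoeff0 mul0r.
rewrite mcoeff_unit_vec (_ : (k == j) = false) ?mul0r//.
by apply: contraNF kj => /eqP ->.
Qed.

(** * Dual automorphisms of the torus *)

Section Dual.
Variable R : realType.
Implicit Types (w : nat -> R) (theta : torus R).

Lemma int_combE (J : choiceType) (w : J -> R) nu : int_comb w nu = fsum w nu.
Proof. by apply: eq_bigr => j _; rewrite mulrzr. Qed.

Lemma circle_continuousD (T : topologicalType) (f g : T -> circle R) :
  continuous f -> continuous g -> continuous (fun x => f x + g x).
Proof.
move=> fc gc x; apply: (@continuous2_cvg T (circle R) (circle R) (circle R)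
  (nbhs x) _ f g (fun u v => u + v) (f x) (g x)); [|exact: fc|exact: gc].
exact: (@circle_add_continuous R (f x, g x)).
Qed.

Lemma circle_continuousMz (T : topologicalType) (f : T -> circle R) (z : int) :
  continuous f -> continuous (fun x => f x *~ z : circle R).
Proof.
move=> fc; have fMn n : continuous (fun x => f x *+ n : circle R).
  elim: n => [|n IH]; first by move=> x; exact: cvg_cst.
  have -> : (fun x => f x *+ n.+1) = (fun x => f x + f x *+ n) :> (T -> circle R).
    by apply/funext => x; rewrite mulrS.
  exact: circle_continuousD.
case: z => n; first exact: fMn.
have -> : (fun x => f x *~ Negz n) =
    (fun u : circle R => - u) \o (fun x => f x *+ n.+1).
  by apply/funext => x; rewrite NegzE mulrNz.
move=> x; apply: continuous_comp; first exact: fMn.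
exact: circle_opp_continuous.
Qed.

Lemma fsum_torus_continuous (nu : Zfs nat) :
  continuous (fun theta => fsum theta nu : circle R).
Proof.
rewrite /fsum; elim: (enum_fset (msupp nu)) => [|k s IH].
  have -> : (fun theta : torus R =>
      \sum_(j <- [::]) theta j *~ mcoeff j nu) = fun=> 0.
    by apply/funext => theta; rewrite big_nil.
  exact: (@cst_continuous _ _ (0 : circle R)).
have -> : (fun theta : torus R => \sum_(j <- k :: s) theta j *~ mcoeff j nu) =
    (fun theta => theta k *~ mcoeff k nu + \sum_(j <- s) theta j *~ mcoeff j nu).
  by apply/funext => theta; rewrite big_cons.
apply: circle_continuousD IH; apply: circle_continuousMz.
exact: (@proj_continuous nat (fun=> circle R)).
Qed.

Lemma torus_continuous (X : topologicalType) (f : X -> torus R) :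
  (forall j, continuous (fun x => f x j)) -> continuous f.
Proof. by move=> fc x; apply: cvg_torus => j; exact: fc. Qed.

(** The torus is the group of homomorphisms from Z^(nat) to the circle, and v
    is an automorphism of Z^(nat): precomposition with it is a homeomorphism,
    because the inverse of v is again given by finitely supported vectors. *)
Lemma basis_change_conjugate w (v : nat -> Zfs nat) : bijective (fsum v) ->
  topologically_conjugate (kronecker_flow w)
    (kronecker_flow (fun i => int_comb w (v i))).
Proof.
move=> [g vK gK].
have gD : zmod_morphism g.
  by move=> x y; apply: (can_inj vK); rewrite gK raddfB /= !gK.
pose ga : {additive Zfs nat -> Zfs nat} :=
  HB.pack g (GRing.isZmodMorphism.Build _ _ g gD).
exists (fun theta i => fsum theta (v i) : circle R).
  split; first by apply: torus_continuous => j; exact: fsum_torus_continuous.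
  exists (fun eta j => fsum eta (g (unit_vec j)) : circle R); split.
  - by apply: torus_continuous => j; exact: fsum_torus_continuous.
  - by move=> theta; apply/funext => j; rewrite -fsum_fsum gK fsum_unit_vec.
  move=> eta; apply/funext => i; rewrite -fsum_fsum.
  rewrite -(additive_fsum ga) /=.
  by rewrite -[v i](fsum_unit_vec v i) vK fsum_unit_vec.
move=> t; apply/funext => theta; apply/funext => i.
pose toc (x : R) : circle R := to_circle (x * t).
have tocB : zmod_morphism toc by move=> x y; rewrite /toc mulrBl to_circleB.
pose toca : {additive R -> circle R} :=
  HB.pack toc (GRing.isZmodMorphism.Build _ _ toc tocB).
rewrite /kronecker_flow /= -[to_circle _]/(toca _) int_combE fsum_morph.
by rewrite -fsumD.
Qed.
End Dual.

(** * Free frequency modules and independent frequencies *)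

Section FrequencyModule.
Variable R : realType.
Implicit Types (w : nat -> R).

Lemma frequency_module_valE (J : choiceType) w (u : J -> frequency_module w) nu :
  val (fsum u nu) = int_comb (fun j => val (u j)) nu.
Proof. by rewrite int_combE fsum_morph. Qed.

Lemma zmod_isomorphic_sym (G H : zmodType) :
  zmod_isomorphic G H -> zmod_isomorphic H G.
Proof.
move=> [f [g fK gK]].
have gB : zmod_morphism g.
  by move=> x y; apply: (can_inj fK); rewrite gK raddfB !gK.
pose ga : {additive H -> G} := HB.pack g (GRing.isZmodMorphism.Build _ _ g gB).
by exists ga, f.
Qed.

Lemma int_comb_mem (J : choiceType) w (u : J -> R) nu :
  (forall j, u j \in in_frequency_module w) ->
  int_comb u nu \in in_frequency_module w.
Proof.
by move=> uw; rewrite int_combE; apply: rpred_sum => j _; rewrite rpredMz.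
Qed.

Lemma topologically_conjugate_sym (X Y : topologicalType) (Phi : R -> X -> X)
    (Psi : R -> Y -> Y) :
  topologically_conjugate Phi Psi -> topologically_conjugate Psi Phi.
Proof.
move=> [h [hc [g [gc hK gK]]] hflow]; exists g; first by split=> //; exists h.
move=> t; apply/funext => y /=; apply: (can_inj hK); rewrite gK.
have /(congr1 (fun f => f (g y))) := hflow t.
by rewrite /= gK.
Qed.

(** Both inclusions between the modules of w and w' are used: one to see the
    nonvanishing w' j inside the module of w, the other for them to span it. *)
Lemma frequency_module_isomorphic w w' :
  topologically_conjugate (kronecker_flow w) (kronecker_flow w') ->
  nonvanishing_independent w' ->
  zmod_isomorphic (frequency_module w) (Zfs (freq_supp w')).
Proof.
move=> conj indep; apply: zmod_isomorphic_sym.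
have w'w := conjugate_frequency_sub conj.
have ww' := conjugate_frequency_sub (topologically_conjugate_sym conj).
pose u (j : freq_supp w') := FrequencyModule (w'w (val j)).
exists (fsum u); apply: inj_surj_bij.
  apply: fsum_inj => nu /(congr1 val); rewrite frequency_module_valE => u0.
  exact: indep.
move=> y; have : val y \in in_frequency_module w'.
  by have /asboolP[nu ->] := valP y; exact: int_comb_mem.
move=> /asboolP[nu yE].
pose r k : Zfs (freq_supp w') := if insub k is Some j then unit_vec j else 0.
exists (fsum r nu); apply: val_inj; rewrite yE.
rewrite -[LHS]/(val (fsum u (fsum r nu))) fsum_fsum frequency_module_valE.
congr int_comb; apply/funext => k; rewrite /r.
case: insubP => [j _ <-|]; first by rewrite fsum_unit_vec.
by rewrite negbK raddf0 => /eqP.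
Qed.

(** The new frequencies are the images of a basis of Z^(nat) adapted to the
    surjection onto the frequency module. *)
Lemma free_frequency_module_conjugate w : free_abelian (frequency_module w) ->
  exists w', topologically_conjugate (kronecker_flow w) (kronecker_flow w') /\
    nonvanishing_independent w'.
Proof.
move=> free_w.
pose phi : {additive Zfs nat -> frequency_module w} :=
  fsum (fun k => FrequencyModule (mem_frequency w k)).
have phiE nu : val (phi nu) = int_comb w nu by exact: frequency_module_valE.
have phi_surj y : exists x, phi x = y.
  have /asboolP[nu yE] := valP y.
  by exists nu; apply: val_inj; rewrite phiE.
have [v [v_bij v_indep]] := adapted_basis phi_surj free_w.
exists (fun i => int_comb w (v i)); split; first exact: basis_change_conjugate.
move=> nu nu0; apply/malgP => j; rewrite mcoeff0.
rewrite -(mcoeff_fsum_inj nu j val_inj); apply: v_indep; last first.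
  by rewrite -val_eqE /= phiE; exact: (valP j).
apply: val_inj; rewrite phiE fsum_fsum /=.
rewrite [LHS]int_combE fsum_fsum -[RHS]nu0 int_combE.
by apply: eq_fsum => i; rewrite fsum_unit_vec int_combE.
Qed.
End FrequencyModule.

Theorem theoremB (R : realType) (w : nat -> R) :
  (free_abelian (frequency_module w) <->
   exists w' : nat -> R,
     topologically_conjugate (kronecker_flow w) (kronecker_flow w') /\
     nonvanishing_independent w') /\
  (forall w' : nat -> R,
     topologically_conjugate (kronecker_flow w) (kronecker_flow w') ->
     nonvanishing_independent w' ->
     zmod_isomorphic (frequency_module w) (Zfs (freq_supp w'))).
Proof.
split=> [|w']; last exact: frequency_module_isomorphic.
split; first exact: free_frequency_module_conjugate.
move=> [w' [conj indep]]; exists (freq_supp w').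
exact: frequency_module_isomorphic.
Qed.
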